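(* Let $\Sigma\subseteq A^{\mathbb M}$ be a sofic subshift, with $A$ a finite alphabet and $\mathbb M\in\{\mathbb N,\mathbb Z\}$. The following statements are equivalent. (i) $\Sigma$ is not universal. (ii) $\Sigma$ is countable. (iii) $\Sigma$ is asymptotically periodic. (iv) $\Sigma$ has no infinite transitive subsystem. (v) $\Sigma$ is the label system of some graph with no non-cyclic strongly connected component.
   Context: $A^{\mathbb M}$ carries the product topology of the discrete topology; the shift is $\sigma(x)_i=x_{i+1}$. A subshift is a nonempty closed set $\Sigma\subseteq A^{\mathbb M}$ with $\sigma(\Sigma)\subseteq\Sigma$ if $\mathbb M=\mathbb N$, and $\sigma(\Sigma)=\Sigma$ if $\mathbb M=\mathbb Z$; it is viewed as the dynamical system $(\Sigma,\sigma)$. A graph on $A$ is a pair $(V,E)$ with $V$ a finite set of vertices and $E\subseteq V\times V\times A$ a finite set of arcs; an arc $(v,w,a)$ goes from $v$ to $w$ and has label $a$. Its label system is the set of sequences $(a_j)_{j\in\mathbb M}$ for which there are arcs $(v_j,w_j,a_j)_{j\in\mathbb M}$ in $E$ with $v_{j+1}=w_j$ whenever $j,j+1\in\mathbb M$. A subshift is sofic if it is the label system of some graph. A strongly connected component is non-cyclic if it contains at least one arc and is not a single cycle (i.e. some vertex of the component has at least two distinct outgoing arcs ending in the component). A subsystem of $(X,F)$ is $(Y,F|_Y)$ with $Y\subseteq X$ nonempty closed and $F(Y)\subseteq Y$. It is transitive if the set of points $y\in Y$ whose positive orbit $\{F^t(y)\mid t\ge1\}$ is dense in $Y$ is residual in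 $Y$. A system $(X,F)$ simulates $(Y,G)$ if there are integers $n,n'\ge1$, a nonempty closed set $X'\subseteq X$ with $F^n(X')\subseteq X'$, and a continuous surjection $\Phi:X'\to Y$ with $\Phi F^n=G^{n'}\Phi$ on $X'$. A subshift $\Sigma\subseteq A^{\mathbb M}$ is universal if it simulates all other subshifts (on any finite alphabet $B$, in $B^{\mathbb M}$ with the same $\mathbb M$). The asymptotic set $\omega_\Sigma$ is the set of all $y\in\Sigma$ such that for some $x\in\Sigma$, $y$ is an adhering value (the limit of a subsequence) of $(\sigma^t(x))_{t\in\mathbb N}$. $\Sigma$ is asymptotically periodic if there is $p\ge1$ with $\sigma^p(y)=y$ for all $y\in\omega_\Sigma$. *)

(* Defs.v *)
From HB Require Import structures.
From mathcomp Require Import all_boot all_order all_algebra.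
From mathcomp Require Import all_classical all_reals.
From mathcomp Require Import topology borel_hierarchy.
Set Implicit Arguments.
Unset Strict Implicit.
Unset Printing Implicit Defensive.

Local Open Scope classical_set_scope.

Variant sidedness := OneSided | TwoSided.

Definition time (M : sidedness) : countType :=
  match M with OneSided => nat | TwoSided => int end.

Definition time_succ (M : sidedness) : time M -> time M :=
  match M with
  | OneSided => fun i : nat => i.+1
  | TwoSided => fun i : int => (i + 1)%R
  end.

Definition full_shift (M : sidedness) (A : finType) : Type :=
  prod_topology (fun _ : time M => discrete_topology A).

HB.instance Definition _ (M : sidedness) (A : finType) :=
  Topological.copy (full_shift M A)
    (prod_topology (fun _ : time M => discrete_topology A)).

Definition shift (M : sidedness) (A : finType) (x : full_shift M A) :
  full_shift M A := fun i => x (time_succ i).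

Definition subshift (M : sidedness) (A : finType)
    (Sigma : set (full_shift M A)) : Prop :=
  [/\ Sigma !=set0,
      closed Sigma &
      match M with
      | OneSided => @shift M A @` Sigma `<=` Sigma
      | TwoSided => @shift M A @` Sigma = Sigma
      end].

Record graph (A : finType) := Graph {
  vertex : finType;
  arcs : {set vertex * vertex * A}
}.

(* An arc e = (v, w, a) has source e.1.1, target e.1.2 and label e.2. *)
Definition label_system (M : sidedness) (A : finType) (G : graph A) :
    set (full_shift M A) :=
  [set x | exists e : time M -> vertex G * vertex G * A,
    [/\ forall j, e j \in arcs G,
        forall j, (e (time_succ j)).1.1 = (e j).1.2 &
        forall j, x j = (e j).2]].

Definition sofic (M : sidedness) (A : finType)
    (Sigma : set (full_shift M A)) : Prop :=
  exists G : graph A, Sigma = label_system G.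

Section StronglyConnectedComponents.
Variables (A : finType) (G : graph A).

Definition adjacent : rel (vertex G) :=
  [rel v w | [exists a, (v, w, a) \in arcs G]].

Definition strongly_connected_component (C : {set vertex G}) : Prop :=
  exists v, C = [set w | connect adjacent v w && connect adjacent w v]%SET.

Definition component_arcs (C : {set vertex G}) :
    {set vertex G * vertex G * A} :=
  [set e in arcs G | (e.1.1 \in C) && (e.1.2 \in C)]%SET.

(* For a strongly connected component with at least one arc, the second
   conjunct says that the component is not a single cycle. *)
Definition non_cyclic (C : {set vertex G}) : Prop :=
  component_arcs C != finset.set0 /\
  exists2 v, v \in C & 1 < #|[set e in component_arcs C | e.1.1 == v]%SET|.

End StronglyConnectedComponents.

(* A dynamical system (X, F) is given by a closed subset X of an ambient space T
   and a self-map F of T with F(X) included in X.  As X is closed in T, the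
   closed subsets of X are the closed subsets of T included in X. *)

Definition subsystem (T : topologicalType) (X : set T) (F : T -> T)
    (Y : set T) : Prop :=
  [/\ Y `<=` X, Y !=set0, closed Y & F @` Y `<=` Y].

Definition residual (T : topologicalType) (S : set T) : Prop :=
  exists2 D, Gdelta_dense D & D `<=` S.

(* Density and residuality are relative to Y: they are taken in the type
   set_type Y, which carries the subspace topology. *)
Definition transitive_system (T : topologicalType) (F : T -> T)
    (Y : set T) : Prop :=
  residual [set y : set_type Y |
    dense [set z : set_type Y |
      exists2 t : nat, 1 <= t & set_val z = iter t F (set_val y)]].

(* Only the values of Phi on X' matter. *)
Definition simulates (T U : topologicalType) (X : set T) (F : T -> T)
    (Y : set U) (G : U -> U) : Prop :=
  exists n n' : nat, exists X' : set T, exists Phi : T -> U,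
    [/\ 1 <= n /\ 1 <= n',
        [/\ X' `<=` X, X' !=set0, closed X' & iter n F @` X' `<=` X'],
        {within X', continuous Phi},
        Phi @` X' = Y &
        {in X', forall x, Phi (iter n F x) = iter n' G (Phi x)}].

Definition universal (M : sidedness) (A : finType)
    (Sigma : set (full_shift M A)) : Prop :=
  forall (B : finType) (Gamma : set (full_shift M B)),
    subshift Gamma -> simulates Sigma (@shift M A) Gamma (@shift M B).

Definition asymptotic_set (M : sidedness) (A : finType)
    (Sigma : set (full_shift M A)) : set (full_shift M A) :=
  [set y | Sigma y /\
    exists2 x, Sigma x &
      exists2 phi : nat -> nat, {homo phi : i j / i < j} &
        (fun k => iter (phi k) (@shift M A) x) @ \oo --> y].

Definition asymptotically_periodic (M : sidedness) (A : finType)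
    (Sigma : set (full_shift M A)) : Prop :=
  exists2 p : nat, 1 <= p &
    forall y, asymptotic_set Sigma y -> iter p (@shift M A) y = y.

(* Main.v *)
Require Import Defs.
From HB Require Import structures.
From mathcomp Require Import all_boot all_order all_algebra.
From mathcomp Require Import all_classical all_reals.
From mathcomp Require Import topology borel_hierarchy.
From mathcomp Require Import zify.

(** The statement is a dichotomy. A sofic subshift [Sigma] is presented by some
    graph without branching strongly connected component, or it contains all
    concatenations of two distinct words of the same length
    ([free_words Sigma]).

    The dichotomy is obtained by replacing the given graph by its backward
    subset construction [preimage_graph], in which an arc is determined by its
    target and its label. It has the same label system
    ([label_system_preimage_graph]; compactness gives the bi-infinite paths). If
    a vertex of this graph has two distinct outgoing arcs inside its strongly
    connected component, they start two loops; running the loops in both orders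
    gives two distinct loops of the same length at that vertex, which have
    distinct labels by codeterminism ([codeterministic_free_words]).

    If there is no branching, then far to the right, and far to the left for
    two-sided time, a path stays in a cycle, so every sequence of [Sigma] is
    eventually periodic with a period that depends on the graph only
    ([right_periodic], [left_periodic]). Hence [Sigma] is countable and
    asymptotically periodic. A countable subshift is not universal, as it cannot
    be mapped onto the uncountable full shift. In an asymptotically periodic
    subshift a transitive subsystem is finite: by Baire's theorem it contains a
    point with dense orbit, and this point is periodic, since otherwise it is an
    adhering value of its own orbit.

    If there are free words, they code every finite alphabet by blocks, which
    makes [Sigma] universal ([free_words_universal]), and all shifts of their
    concatenations form an infinite transitive subsystem
    ([free_words_transitive]).

    One-sided and two-sided time are treated together: the functions [time_abs],
    [time_add], [time_div] and so on give both the arithmetic that is needed,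
    and the topology is expressed by agreement on finite windows. *)

Set Implicit Arguments.
Unset Strict Implicit.
Unset Printing Implicit Defensive.
Import Order.TTheory GRing.Theory Num.Theory.
Local Open Scope classical_set_scope.

(** * Arithmetic of time and topology of the full shift *)

Definition time_abs (M : sidedness) : time M -> nat :=
  match M with OneSided => fun i : nat => i | TwoSided => absz end.

Definition time_add (M : sidedness) : time M -> nat -> time M :=
  match M with
  | OneSided => addn
  | TwoSided => fun (i : int) k => (i + k%:Z)%R
  end.

Definition time_of_nat (M : sidedness) : nat -> time M :=
  match M with OneSided => fun n => n | TwoSided => Posz end.

Definition time_mul (M : sidedness) : time M -> nat -> time M :=
  match M with
  | OneSided => muln
  | TwoSided => fun (i : int) n => (i * n%:Z)%R
  end.

Definition time_div (M : sidedness) : time M -> nat -> time M :=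
  match M with
  | OneSided => divn
  | TwoSided => fun (i : int) n => (i %/ n%:Z%R)%Z
  end.

Definition time_mod (M : sidedness) : time M -> nat -> nat :=
  match M with
  | OneSided => modn
  | TwoSided => fun (i : int) n => `|(i %% n%:Z%R)%Z|%N
  end.

Section Time.
Variable M : sidedness.
Implicit Types (i j : time M) (k m n : nat).

Lemma time_succE i : time_succ i = time_add i 1.
Proof. by case: M i => //= i; rewrite addn1. Qed.

Lemma time_add0 i : time_add i 0 = i.
Proof. by case: M i => /= i; rewrite ?addn0 ?addr0. Qed.

Lemma time_addA i k m : time_add (time_add i k) m = time_add i (k + m).
Proof. by case: M i => /= i; rewrite ?addnA ?PoszD ?addrA. Qed.

Lemma time_addS i k : time_add i k.+1 = time_succ (time_add i k).
Proof. by rewrite time_succE time_addA addn1. Qed.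

Lemma time_abs_add i k : time_abs (time_add i k) <= time_abs i + k.
Proof. by case: M i => /= i; lia. Qed.

Lemma time_abs_of_nat k : time_abs (time_of_nat M k) = k.
Proof. by case: M. Qed.

Lemma time_of_nat_add k m : time_add (time_of_nat M k) m = time_of_nat M (k + m).
Proof. by case: M => //=; rewrite PoszD. Qed.

Lemma time_add_large i k m : time_abs i + k <= m ->
  exists2 j, k <= j & time_add i m = time_of_nat M j.
Proof.
case: M i => /= i im; first by exists (i + m) => //; lia.
by exists `|(i + m%:Z)%R|%N; lia.
Qed.

Lemma time_mod_lt i n : 0 < n -> time_mod i n < n.
Proof.
move=> n0; case: M i => /= i; first by rewrite ltn_mod.
have nz : (n%:Z != 0)%R by lia.
by have := ltz_mod i nz; have := modz_ge0 i nz; lia.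
Qed.

Lemma time_divK i n : 0 < n ->
  i = time_add (time_mul (time_div i n) n) (time_mod i n).
Proof.
move=> n0; case: M i => /= i; first exact: divn_eq.
have nz : (n%:Z != 0)%R by lia.
by rewrite gez0_abs ?modz_ge0 // -divz_eq.
Qed.

Lemma time_div_add j n k : k < n -> time_div (time_add (time_mul j n) k) n = j.
Proof.
move=> kn; case: M j => /= j.
  by rewrite divnMDl ?divn_small ?addn0 //; lia.
by rewrite divzMDl ?divz_small ?addr0 //; lia.
Qed.

Lemma time_mod_add j n k : k < n -> time_mod (time_add (time_mul j n) k) n = k.
Proof.
move=> kn; case: M j => /= j; first by rewrite modnMDl modn_small.
by rewrite modzMDl modz_small //; lia.
Qed.

Lemma time_mul_add j k n :
  time_mul (time_add j k) n = time_add (time_mul j n) (k * n).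
Proof. by case: M j => /= j; [rewrite mulnDl | rewrite mulrDl PoszM]. Qed.

Lemma time_abs_mul j n : time_abs (time_mul j n) = time_abs j * n.
Proof. by case: M j => //= j; rewrite abszM. Qed.

Lemma time_abs_div i n : time_abs (time_div i n) <= time_abs i.
Proof.
case: M i => /= i; first exact: leq_div.
case: n => [|n]; first by rewrite divz0.
have nz : (n.+1%:Z != 0)%R by [].
have := divz_eq i n.+1; have := modz_ge0 i nz; have := ltz_pmod i (isT : (0 < n.+1%:Z)%R).
set q := (i %/ _)%Z; set r := (i %% _)%Z => r1 r2 ->.
by case: q => q; nia.
Qed.

Lemma time_succ_block i n : 0 < n ->
  (time_div (time_succ i) n, time_mod (time_succ i) n) =
  if (time_mod i n).+1 < n then (time_div i n, (time_mod i n).+1)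
  else (time_succ (time_div i n), 0).
Proof.
move=> n0; rewrite {1 2}(time_divK i n0) -time_addS.
have := time_mod_lt i n0; set q := time_div i n; set r := time_mod i n => rn.
case: ifP => [r1|r1]; first by rewrite time_div_add // time_mod_add.
have -> : r.+1 = n by lia.
have -> : time_add (time_mul q n) n = time_add (time_mul (time_succ q) n) 0.
  by rewrite time_succE time_mul_add mul1n time_add0.
by rewrite time_div_add // time_mod_add.
Qed.

Lemma time_window_seq m : exists s : seq (time M), forall i, time_abs i < m -> i \in s.
Proof.
case: M => /=.
  by exists (iota 0 m) => i; rewrite mem_iota.
exists ([seq Posz k | k <- iota 0 m] ++ [seq (- Posz k)%R | k <- iota 0 m]).
move=> i im; rewrite mem_cat; apply/orP.
case: (lerP 0 i) => i0; [left | right]; apply/mapP; exists (absz i);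
  rewrite ?mem_iota //; lia.
Qed.

Variable A : finType.
Implicit Types x y : full_shift M A.

Lemma iter_shiftE k x i : iter k (@shift M A) x i = x (time_add i k).
Proof.
elim: k i => [|k IH] i; first by rewrite time_add0.
by rewrite iterS {1}/shift IH time_succE time_addA add1n.
Qed.

Definition agree m x y := forall i, time_abs i < m -> x i = y i.

Lemma agreexx m x : agree m x x. Proof. by []. Qed.

Lemma agree_sym m x y : agree m x y -> agree m y x.
Proof. by move=> xy i im; rewrite xy. Qed.

Lemma agree_trans m x y z : agree m x y -> agree m y z -> agree m x z.
Proof. by move=> xy yz i im; rewrite xy ?yz. Qed.

Lemma agree_le m n x y : n <= m -> agree m x y -> agree n x y.
Proof. by move=> nm xy i im; apply: xy; apply: leq_trans im nm. Qed.

Lemma agree_shift m k x y : agree (m + k) x y ->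
  agree m (iter k (@shift M A) x) (iter k (@shift M A) y).
Proof.
move=> xy i im; rewrite !iter_shiftE; apply: xy.
by apply: leq_ltn_trans (time_abs_add _ _) _; rewrite ltn_add2r.
Qed.

End Time.

Section Cylinders.
Variables (M : sidedness) (A : finType).
Implicit Types (x y : full_shift M A) (B S : set (full_shift M A)).

Lemma nbhs_agree m x : nbhs x [set y | agree m x y].
Proof.
have [s sP] := time_window_seq M m.
have coord i : nbhs x [set y | y i = x i].
  have /(_ x) c := @proj_continuous (time M) (fun=> discrete_topology A) i.
  exact: (c [set x i] (@discrete_set1 (discrete_topology A) (x i))).
have : nbhs x [set y | forall i, i \in s -> x i = y i].
  elim: s {sP} => [|i s IH]; first exact: filterE.
  apply: filterS (filterI (coord i) IH) => y [/= yi ys] j.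
  by rewrite inE => /orP[/eqP -> //|]; apply: ys.
by apply: filterS => y ys i im; apply: ys; apply: sP.
Qed.

(** The filter generated by the cylinders around [x] converges to [x] in every
    coordinate, hence in the product topology, so it contains every
    neighbourhood of [x]. This lemma turns all topology below into statements
    about agreement on finite windows. *)
Lemma nbhs_agreeP x B : nbhs x B <-> exists m, forall y, agree m x y -> B y.
Proof.
split; last by case=> m mB; apply: filterS (nbhs_agree m x) => y /mB.
pose F : set_system (full_shift M A) :=
  [set B | exists m, forall y, agree m x y -> B y].
have FF : Filter F.
  split; first by exists 0.
    move=> P Q [m mP] [n nQ]; exists (maxn m n) => y xy; split.
      by apply: mP; apply: agree_le xy; rewrite leq_maxl.
    by apply: nQ; apply: agree_le xy; rewrite leq_maxr.
  by move=> P Q PQ [m mP]; exists m => y /mP/PQ.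
suff: F --> x by move/(_ B).
apply/cvg_sup => i.
apply/cvg_image.
  by apply/seteqP; split=> // a _; exists (fun=> a).
move=> U /= Ux; exists [set y | U (y i)].
  by exists (time_abs i).+1 => y xy /=; rewrite -xy //; exact: Ux.
apply/seteqP; split=> [a [y Uy <-]//|a Ua]; by exists (fun=> a).
Qed.

Lemma closed_agreeP S :
  closed S <-> forall x, (forall m, exists2 y, S y & agree m x y) -> S x.
Proof.
split=> [cS x xS|H x xS]; last first.
  by apply: H => m; have [y [Sy xy]] := xS _ (nbhs_agree m x); exists y.
apply: cS => B /nbhs_agreeP [m mB]; have [y Sy xy] := xS m.
by exists y; split=> //; apply: mB.
Qed.

Lemma open_agreeP S :
  open S <-> forall x, S x -> exists m, forall y, agree m x y -> S y.
Proof.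
rewrite openE; split=> H x /H; first by move/nbhs_agreeP.
by move=> ?; apply/nbhs_agreeP.
Qed.

Lemma full_shift_compact : compact [set: full_shift M A].
Proof.
have fA : finite_set [set: discrete_topology A] by exact: (@finite_finset A).
have := @tychonoff (time M) (fun=> discrete_topology A) (fun=> setT)
  (fun=> finite_compact fA).
by congr (compact _); apply/seteqP; split.
Qed.

Lemma full_shift_hausdorff : hausdorff_space (full_shift M A).
Proof. by apply: hausdorff_product => i; exact: discrete_hausdorff. Qed.

(** Compactness in the form used below: to find a sequence with infinitely many
    local properties, it is enough to find, for each finite window, a sequence
    that has the properties inside that window. *)
Lemma cluster_agree (s : nat -> full_shift M A) :
  exists x, forall m N, exists2 n, N <= n & agree m x (s n).
Proof.
have [x [_ xs]] := @full_shift_compact (s @ \oo) _ filterT.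
exists x => m N.
have : (s @ \oo) [set y | exists2 n, N <= n & y = s n].
  by exists N => // n /= Nn; exists n.
move=> /xs /(_ (nbhs_agree m x)) [y [[n Nn ->] xy]].
by exists n.
Qed.

End Cylinders.

Section Continuity.
Variables (M : sidedness) (A B : finType).

Lemma continuous_agree (f : full_shift M A -> full_shift M B) :
  (forall m, exists n, forall x y, agree n x y -> agree m (f x) (f y)) ->
  continuous f.
Proof.
move=> H x U /nbhs_agreeP [m mU]; have [n nm] := H m.
by apply/nbhs_agreeP; exists n => y /nm/mU.
Qed.

Lemma closed_image (f : full_shift M A -> full_shift M B) S :
  continuous f -> closed S -> closed (f @` S).
Proof.
move=> cf cS; apply: compact_closed; first exact: full_shift_hausdorff.
apply: continuous_compact; first exact/continuous_subspaceT.
exact: (subclosed_compact cS (@full_shift_compact M A)).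
Qed.

End Continuity.

(** * Free words, universality and countability *)

Lemma subshift_shift (M : sidedness) (A : finType) (Sigma : set (full_shift M A)) x :
  subshift Sigma -> Sigma x -> Sigma (shift x).
Proof.
by case: M Sigma x => Sigma x [_ _ H] Sx; [apply: H | rewrite -H]; exists x.
Qed.

Lemma subshift_iter_shift (M : sidedness) (A : finType)
    (Sigma : set (full_shift M A)) x k :
  subshift Sigma -> Sigma x -> Sigma (iter k (@shift M A) x).
Proof. by move=> sS Sx; elim: k => //= k; apply: subshift_shift. Qed.

Section Blocks.
Variables (M : sidedness) (A B : finType) (n : nat) (c : B -> nat -> A).
Implicit Types z : full_shift M B.

Definition block_concat z : full_shift M A :=
  fun i => c (z (time_div i n)) (time_mod i n).

Lemma block_concatE z j k : k < n ->
  block_concat z (time_add (time_mul j n) k) = c (z j) k.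
Proof. by move=> kn; rewrite /block_concat time_div_add // time_mod_add. Qed.

Lemma agree_block_concat m z z' :
  agree m z z' -> agree m (block_concat z) (block_concat z').
Proof.
move=> zz i im; rewrite /block_concat zz //.
exact: leq_ltn_trans (time_abs_div _ _) im.
Qed.

Lemma iter_shift_block_concat k z : 0 < n ->
  iter (k * n) (@shift M A) (block_concat z) =
  block_concat (iter k (@shift M B) z).
Proof.
move=> n0; apply/funext => i; rewrite iter_shiftE {1}(time_divK i n0) time_addA.
rewrite addnC -time_addA -time_mul_add block_concatE ?time_mod_lt //.
by rewrite /block_concat iter_shiftE.
Qed.

End Blocks.

(** The two words have length [n] and are given by [c]; the bit sequence [z]
    tells in which order they are concatenated. Since they differ at position
    [q], the letters of a concatenation at the [q]-th places of the blocks
    determine [z]. *)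
Definition free_words (M : sidedness) (A : finType) (Sigma : set (full_shift M A)) :=
  exists n (c : bool -> nat -> A) q, [/\ q < n, c true q != c false q &
    forall z : full_shift M bool, Sigma (block_concat n c z)].

(** Any finite alphabet can be coded by words over the two free words, all of the
    same length. Coding a subshift letter by letter gives a closed set, on which
    shifting by the length of a code word becomes the shift of the original
    subshift; decoding only looks at finitely many letters, so it is
    continuous. *)
Lemma free_words_universal (M : sidedness) (A : finType)
    (Sigma : set (full_shift M A)) :
  subshift Sigma -> free_words Sigma -> universal Sigma.
Proof.
move=> sS [n [c [q [qn cq cS]]]] B Gamma sG.
have [[y0 Gy0] cG _] := sG.
have n0 : 0 < n by apply: leq_ltn_trans qn.
pose b0 : B := y0 (time_of_nat M 0).
pose m := #|B|.
have m0 : 0 < m by apply/card_gt0P; exists b0.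
(* The letter of rank r is coded by m bits, of which only the r-th is true. *)
pose d (b : B) (k : nat) := k == enum_rank b.
pose Psi (y : full_shift M B) : full_shift M A :=
  block_concat n c (block_concat m d y).
(* At this place one reads off whether the j-th letter is b. *)
pose pos (j : time M) (b : B) : time M :=
  time_add (time_mul (time_add (time_mul j m) (enum_rank b)) n) q.
pose Phi (x : full_shift M A) : full_shift M B :=
  fun j => odflt b0 [pick b | x (pos j b) == c true q].
have PsiK y : Phi (Psi y) = y.
  apply/funext => j; rewrite /Phi.
  have E b : (Psi y (pos j b) == c true q) = (b == y j).
    rewrite /Psi /pos !block_concatE ?ltn_ord // /d (inj_eq val_inj).
    rewrite (inj_eq enum_rank_inj).
    by case: (b == y j); rewrite ?eqxx //; apply: negbTE; rewrite eq_sym.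
  by case: pickP => [b|/(_ (y j))]; rewrite E ?eqxx // => /eqP.
have PsiC : continuous Psi.
  by apply: continuous_agree => k; exists k => x y xy; do 2!apply: agree_block_concat.
have PhiC : continuous Phi.
  apply: continuous_agree => k; exists ((k * m + m) * n + n) => x y xy j jk.
  congr odflt; apply: eq_pick => b; congr (_ == _); apply: xy.
  apply: leq_ltn_trans (time_abs_add _ _) _; rewrite time_abs_mul.
  rewrite -addnS leq_add // leq_mul //.
  apply: leq_trans (time_abs_add _ _) _; rewrite time_abs_mul.
  by rewrite leq_add // ?leq_mul // ltnW ?ltn_ord.
have PsiS y : iter (m * n) (@shift M A) (Psi y) = Psi (shift y).
  by rewrite /Psi iter_shift_block_concat // -[m in iter m]mul1n iter_shift_block_concat.
exists (m * n), 1, (Psi @` Gamma), Phi; split.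
- by rewrite muln_gt0 m0 n0.
- split; first by move=> _ [y _ <-]; apply: cS.
  + by exists (Psi y0), y0.
  + exact: closed_image.
  + move=> _ [_ [y Gy <-] <-]; exists (shift y); first exact: subshift_shift.
    by rewrite PsiS.
- exact: continuous_subspaceT.
- apply/seteqP; split=> [_ [_ [y Gy <-] <-]|y Gy]; first by rewrite PsiK.
  by exists (Psi y); [exists y | rewrite PsiK].
- by move=> x; rewrite inE => -[y Gy <-]; rewrite PsiS !PsiK.
Qed.

(** Cantor's diagonal argument along the nonnegative times. *)
Lemma full_shift_bool_uncountable (M : sidedness) :
  ~ countable [set: full_shift M bool].
Proof.
move=> /countable_injP [f finj].
have fI x y : f x = f y -> x = y by apply: finj; rewrite inE.
pose x : full_shift M bool :=
  fun i => `[< forall y : full_shift M bool, f y = time_abs i -> y i = false >].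
have xE := erefl (x (time_of_nat M (f x))).
rewrite {1}/x time_abs_of_nat in xE.
case E: (x (time_of_nat M (f x))) xE => /asboolP.
  by move/(_ x erefl); rewrite E.
by case=> y /fI ->.
Qed.

(** Simulating the full shift on two letters would map a subset of [Sigma] onto
    an uncountable set. *)
Lemma countable_not_universal (M : sidedness) (A : finType)
    (Sigma : set (full_shift M A)) :
  countable Sigma -> ~ universal Sigma.
Proof.
move=> cS uS; apply: (@full_shift_bool_uncountable M).
have sT : subshift [set: full_shift M bool].
  split; [by exists (fun=> true) | exact: closedT |].
  case: M {Sigma cS uS} => //; apply/seteqP; split=> // x _.
  by exists (fun i => x (i - 1)%R) => //; apply/funext => i; rewrite /shift /= addrK.
have [n [n' [X' [Phi [_ [XS _ _ _] _ <- _]]]]] := uS _ _ sT.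
apply: sub_countable (card_image_le _ _) _.
by apply: sub_countable (subset_card_le XS) cS.
Qed.

(** * A transitive subsystem from free words *)

Section FreeWordsTransitive.
Variables (M : sidedness) (A : finType) (Sigma : set (full_shift M A)).
Hypothesis sS : subshift Sigma.
Variables (n : nat) (c : bool -> nat -> A) (q : nat).
Hypotheses (qn : q < n) (cq : c true q != c false q).
Hypothesis cS : forall z : full_shift M bool, Sigma (block_concat n c z).

Local Notation bits := (full_shift M bool).
Let n0 : 0 < n. Proof. exact: leq_ltn_trans qn. Qed.

Let concat_shift (k : nat) (z : bits) : full_shift M A :=
  iter k (@shift M A) (block_concat n c z).

(** All shifts of concatenations of the two words. Shifting by the word length
    [n] shifts the bit sequence, so shifts by less than [n] suffice, and the set
    is a finite union of compact sets. *)
Definition concat_orbits : set (full_shift M A) :=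
  \bigcup_(k in `I_n) (concat_shift k @` [set: bits]).

Lemma concat_orbitsE y :
  concat_orbits y <-> exists k z, y = concat_shift k z.
Proof.
split=> [[k _ [z _ <-]]|[k [z ->]]]; first by exists k, z.
exists (k %% n); first by rewrite /= ltn_mod.
exists (iter (k %/ n) (@shift M bool) z) => //.
by rewrite /concat_shift -iter_shift_block_concat // -iterD addnC -divn_eq.
Qed.

Lemma agree_concat_shift m k z z' : agree (m + k) z z' ->
  agree m (concat_shift k z) (concat_shift k z').
Proof. by move=> zz; apply: agree_shift; apply: agree_block_concat. Qed.

Lemma concat_orbits_shift y t :
  concat_orbits y -> concat_orbits (iter t (@shift M A) y).
Proof.
move=> /concat_orbitsE [k [z ->]]; apply/concat_orbitsE.
by exists (t + k), z; rewrite /concat_shift iterD.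
Qed.

Lemma concat_orbits_subsystem : subsystem Sigma (@shift M A) concat_orbits.
Proof.
split.
- by move=> _ /concat_orbitsE [k [z ->]]; apply: subshift_iter_shift.
- by exists (concat_shift 0 (fun=> true)); apply/concat_orbitsE; exists 0, (fun=> true).
- apply: closed_bigcup; first exact: finite_II.
  move=> k _; apply: closed_image; last exact: closedT.
  by apply: continuous_agree => m; exists (m + k) => x y; apply: agree_concat_shift.
- by move=> _ [y Yy <-]; apply: (concat_orbits_shift 1).
Qed.

Lemma block_concat_inj : injective (block_concat n c : bits -> _).
Proof.
move=> z z' zz; apply/funext => j.
have := congr1 (fun x : full_shift M A => x (time_add (time_mul j n) q)) zz.
rewrite !block_concatE //; case: (z j) (z' j) => -[] // E;
  by have := cq; rewrite E eqxx.
Qed.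

Lemma concat_orbits_infinite : infinite_set concat_orbits.
Proof.
move=> fY; apply: (@full_shift_bool_uncountable M).
have : countable (block_concat n c @` [set: bits]).
  apply: finite_set_countable; apply: sub_finite_set fY => _ [z _ <-].
  by apply/concat_orbitsE; exists 0, z.
  have : (block_concat n c @` [set: bits] #= [set: bits])%card.
    by apply: inj_card_eq => x y _ _; apply: block_concat_inj.
  by rewrite card_eq_le => /andP[_]; apply: sub_countable.
Qed.

Lemma splice (B : finType) m m' T (z z' : full_shift M B) : m + m' <= T ->
  exists w, agree m z w /\ agree m' z' (iter T (@shift M B) w).
Proof.
case: M z z' => /= z z' mT.
  exists (fun i : nat => if i < m then z i else z' (i - T)); split.
    by move=> i /= ->.
  move=> i /= im; rewrite iter_shiftE /= ifF; last by lia.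
  by rewrite addnK.
exists (fun i : int => if (i < m%:Z)%R then z i else z' (i - T%:Z)%R); split.
  by move=> i /= im; rewrite ifT //; lia.
move=> i /= im; rewrite iter_shiftE /= ifF; last by lia.
by rewrite addrK.
Qed.

(** Topological mixing comes from gluing the two bit sequences. The second one
    is glued at a distance [T], and the time shift [T * n] is corrected by the
    phases of [y] and [y'] within a word. *)
Lemma concat_orbits_mixing m m' y y' : concat_orbits y -> concat_orbits y' ->
  exists2 w, concat_orbits w & agree m y w /\
    exists2 t, 1 <= t & agree m' y' (iter t (@shift M A) w).
Proof.
move=> /concat_orbitsE [k [z ->]] /concat_orbitsE [k' [z' ->]].
pose T := (m + k) + (m' + k') + k + 1.
have [w [zw z'w]] := @splice bool (m + k) (m' + k') T z z' ltac:(lia).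
exists (concat_shift k w); first by apply/concat_orbitsE; exists k, w.
split; first exact: agree_concat_shift.
exists (k' + T * n - k); first by rewrite /T; nia.
rewrite /concat_shift -iterD subnK; last by rewrite /T; nia.
by rewrite iterD iter_shift_block_concat //; apply: agree_concat_shift.
Qed.

(** The points whose orbit visits a given cylinder form an open set, which is
    dense by mixing. The points with dense orbit are those in the intersection
    of these sets over a countable family of cylinders. *)
Lemma concat_orbits_transitive : transitive_system (@shift M A) concat_orbits.
Proof.
(* Countably many targets suffice: shifts of concatenations driven by bit
   sequences that are eventually false. *)
pose bits_of (w : seq bool) : bits := fun i => nth false w (pickle i).
have bits_ofP m z : exists w, agree m z (bits_of w).
  have [s sP] := time_window_seq M m.
  pose N := (\max_(i <- s) pickle i).+1.
  exists (mkseq (fun k => if unpickle k is Some i then z i else false) N).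
  move=> i /sP si; rewrite /bits_of nth_mkseq ?pickleK //.
  by rewrite ltnS; apply: leq_bigmax_seq.
pose O' (u : nat * seq bool * nat) : set (full_shift M A) :=
  [set y | exists2 t, 1 <= t &
     agree u.2 (concat_shift u.1.1 (bits_of u.1.2)) (iter t (@shift M A) y)].
have O'open u : open (O' u).
  apply/open_agreeP => y [t t1 yt]; exists (u.2 + t) => y' yy'.
  by exists t => //; apply: agree_trans yt _; apply: agree_shift.
pose O (i : nat) : set (set_type concat_orbits) :=
  if unpickle i is Some u then set_val @^-1` O' u else setT.
exists (\bigcap_i O i).
  exists O => // i; rewrite /O; case: unpickle => [u|]; last first.
    by split; [exact: openT | move=> U [y Uy] _; exists y].
  split; first by exists (O' u).
  move=> V [y Vy] [U oU UE]; move: Vy; rewrite -UE => Uy.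
  have /open_agreeP /(_ _ Uy) [m mU] := oU.
  have [w Yw [yw [t t1 tw]]] := concat_orbits_mixing m u.2 (set_valP y)
    (proj2 (concat_orbitsE _) (ex_intro _ u.1.1 (ex_intro _ (bits_of u.1.2) erefl))).
  exists (SigSub (mem_set Yw)); split; first exact: mU.
  by exists t.
move=> y Oy V [y' Vy'] [U oU UE]; move: Vy'; rewrite -UE => Uy'.
have /open_agreeP /(_ _ Uy') [m mU] := oU.
have /concat_orbitsE [k [z y'E]] := set_valP y'.
have [w zw] := bits_ofP (m + k) z.
have := Oy (pickle (k, w, m)) I; rewrite /O pickleK => -[t t1 tw].
exists (SigSub (mem_set (concat_orbits_shift t (set_valP y)))).
split; last by exists t.
by have := agree_trans (agree_concat_shift zw) tw; rewrite -y'E; apply: mU.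
Qed.

End FreeWordsTransitive.

Lemma free_words_transitive (M : sidedness) (A : finType)
    (Sigma : set (full_shift M A)) :
  subshift Sigma -> free_words Sigma ->
  exists Y : set (full_shift M A),
    [/\ subsystem Sigma (@shift M A) Y, transitive_system (@shift M A) Y &
        infinite_set Y].
Proof.
move=> sS [n [c [q [qn cq cS]]]]; exists (@concat_orbits M A n c); split.
- exact: (concat_orbits_subsystem sS qn cS).
- exact: (@concat_orbits_transitive M A n c q qn).
- exact: (concat_orbits_infinite qn cq).
Qed.

(** * The backward subset construction *)

Section PreimageGraph.
Variables (A : finType) (G : graph A).
Local Notation V := (vertex G).

Definition label_preimage (T : {set V}) (a : A) : {set V} :=
  [set v | [exists w in T, (v, w, a) \in arcs G]]%SET.

(** The subset construction run backwards: an arc goes from the set of all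
    possible predecessors to the set itself, so that an arc is determined by
    its target and its label. *)
Definition preimage_graph : graph A :=
  @Graph A {set V} [set E | (E.1.1 != finset.set0) &&
                            (E.1.1 == label_preimage E.1.2 E.2)]%SET.

Lemma preimage_graph_codeterministic (E E' : {set V} * {set V} * A) :
  E \in arcs preimage_graph -> E' \in arcs preimage_graph ->
  E.1.2 = E'.1.2 -> E.2 = E'.2 -> E = E'.
Proof.
case: E E' => [[S T] a] [[S' T'] a']; rewrite !inE /=.
by move=> /andP[_ /eqP ->] /andP[_ /eqP ->] -> ->.
Qed.

Variable M : sidedness.

(** [s] is a time before the whole window of radius [n]; [idx] counts the steps
    from [s]. *)
Lemma time_start n : exists (s : time M) (idx : time M -> nat),
  forall i, time_abs i <= n ->
    i = time_add s (idx i) /\ idx (time_succ i) = (idx i).+1.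
Proof.
case: M => /=; first by exists 0, id => i _; rewrite add0n.
by exists (- n%:Z)%R, (fun i => `|(i + n%:Z)%R|%N) => i im; split; lia.
Qed.

(** As vertex set at time [j], take the vertices from which the sequence can be
    read from time [j] on. It is the exact preimage of the next one, and this
    works for one-sided and two-sided time alike. *)
Lemma label_system_sub_preimage :
  (label_system G : set (full_shift M A)) `<=` label_system preimage_graph.
Proof.
move=> x [e [eG ec ex]].
pose reads (j : time M) (v : V) := exists r : nat -> V * V * A,
  [/\ forall k, r k \in arcs G, forall k, (r k.+1).1.1 = (r k).1.2,
      forall k, (r k).2 = x (time_add j k) & (r 0).1.1 = v].
pose S j : {set V} := [set v | `[< reads j v >]]%SET.
exists (fun j => (S j, S (time_succ j), x j)); split=> // j.
rewrite inE /=; apply/andP; split.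
  apply/set0Pn; exists (e j).1.1; rewrite inE; apply/asboolP.
  exists (fun k => e (time_add j k)); split=> // [k|]; last by rewrite time_add0.
  by rewrite time_addS ec.
apply/eqP/setP => v; rewrite !inE; apply/asboolP/existsP.
  case=> r [rG rc rx <-]; exists (r 0).1.2; rewrite inE; apply/andP; split.
    apply/asboolP; exists (fun k => r k.+1); split=> // k.
    by rewrite rx time_succE time_addA.
  by have := rG 0; have := rx 0; rewrite time_add0 => <-; case: (r 0) => [[]].
case=> w; rewrite inE => /andP[/asboolP [r [rG rc rx rw]] vw].
exists (fun k => if k is k'.+1 then r k' else (v, w, x j)); split=> // -[|k] //=.
- by rewrite time_add0.
- by rewrite rx time_succE time_addA.
Qed.

(** Inside the vertex sets, arcs can be chosen one after the other from any
    time on, and compactness lets the starting time tend to minus infinity. *)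
Lemma preimage_sub_label_system :
  label_system preimage_graph `<=` (label_system G : set (full_shift M A)).
Proof.
move=> x [E [EG Ec Ex]].
pose S j : {set V} := (E j).1.1.
have S0 j : S j != finset.set0 by have := EG j; rewrite inE => /andP[].
have next j v : exists e : V * V * A, v \in S j ->
    [/\ e \in arcs G, e.1.1 = v, e.1.2 \in S (time_succ j) & e.2 = x j].
  case: (boolP (v \in S j)) => [|_]; last by exists (v, v, x j).
  have := EG j; rewrite inE => /andP[_ /eqP]; rewrite -/(S j) => ->.
  rewrite inE => /existsP [w /andP[wS vw]]; exists (v, w, (E j).2) => _.
  by rewrite /S Ec Ex.
have /all_tag [f fP] := fun j => choice (next j).
have approx n : exists e : full_shift M (V * V * A)%type, forall i,
    time_abs i <= n -> [/\ e i \in arcs G,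
      (e (time_succ i)).1.1 = (e i).1.2 & x i = (e i).2].
  have [s [idx idxP]] := time_start n.
  have /set0Pn [v0 v0S] := S0 s.
  pose v := fix v k := if k is k'.+1 then (f (time_add s k') (v k')).1.2 else v0.
  have vS k : v k \in S (time_add s k).
    elim: k => [|k /fP [_ _]]; first by rewrite time_add0.
    by rewrite time_addS.
  pose r k := f (time_add s k) (v k).
  exists (fun i => r (idx i)) => i /idxP [iE idxS].
  have [rG _ _ rx] := fP _ _ (vS (idx i)).
  split=> //; last by rewrite rx -iE.
  by rewrite idxS; have [_ -> _ _] := fP _ _ (vS (idx i).+1).
have [es esP] := choice approx.
have [e eP] := cluster_agree es.
have {}eP i : [/\ e i \in arcs G, (e (time_succ i)).1.1 = (e i).1.2 & x i = (e i).2].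
  have [n ni ee] := eP (time_abs i).+2 (time_abs i).
  rewrite !ee //; first exact: esP.
  by rewrite time_succE; have := time_abs_add i 1; lia.
by exists e; split=> i; have [] := eP i.
Qed.

Lemma label_system_preimage_graph :
  (label_system preimage_graph : set (full_shift M A)) = label_system G.
Proof.
apply/seteqP; split; first exact: preimage_sub_label_system.
exact: label_system_sub_preimage.
Qed.

End PreimageGraph.

(** * Branching components and free words *)

Section ReturningArcs.
Variables (A : finType) (G : graph A).
Local Notation V := (vertex G).
Local Notation arc := (V * V * A)%type.
Implicit Types (e : arc) (v w : V) (s : seq arc).

(** These are the arcs with both ends in one strongly connected component: the
    arcs that can be closed up to a loop. *)
Definition returning e := (e \in arcs G) && connect (@adjacent A G) e.1.2 e.1.1.

Definition unique_returning_arc :=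
  forall e e', returning e -> returning e' -> e.1.1 = e'.1.1 -> e = e'.

Lemma arc_connect e : e \in arcs G -> connect (@adjacent A G) e.1.1 e.1.2.
Proof.
by case: e => [[v w] a] eG; apply/connect1/existsP; exists a.
Qed.

(** Both sides say that no strongly connected component has a branching. The
    condition on arcs spares the rest of the proof from handling components. *)
Lemma no_non_cyclicP :
  ~ (exists C : {set V}, strongly_connected_component C /\ non_cyclic C) <->
  unique_returning_arc.
Proof.
split=> [noC e e' /andP[eG er] /andP[eG' er'] ee'|uniq [C [[v0 ->]]]].
  apply: contrapT => /eqP ne; apply: noC.
  exists [set w | connect (@adjacent A G) e.1.1 w &&
                  connect (@adjacent A G) w e.1.1]%SET.
  split; first by exists e.1.1.
  set C := finset _.
  have inC e1 : e1 \in arcs G -> e1.1.1 = e.1.1 ->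
      connect (@adjacent A G) e1.1.2 e1.1.1 -> e1 \in component_arcs C.
    move=> e1G e1e e1r; rewrite !inE e1G e1e connect0 /= -e1e e1r andbT.
    exact: arc_connect.
  split; first by apply/set0Pn; exists e; apply: inC.
  exists e.1.1; first by rewrite inE connect0.
  apply/card_gt1P; exists e, e'; split; rewrite ?ne //; apply/setIdP; split;
    by [apply: inC | rewrite ?ee'].
case=> _ [v _ /card_gt1P [e [e' []]]].
rewrite !inE => /andP[/andP[eG /andP[/andP[ec _] /andP[_ er]]] /eqP ev].
move=> /andP[/andP[eG' /andP[/andP[ec' _] /andP[_ er']]] /eqP ev'].
move=> /eqP; apply; apply: uniq; last by rewrite ev.
  by rewrite /returning eG (connect_trans er).
by rewrite /returning eG' (connect_trans er').
Qed.

Fixpoint walk v s w : bool :=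
  if s is e :: s' then [&& e \in arcs G, e.1.1 == v & walk e.1.2 s' w]
  else v == w.

Lemma walk_cat v s w s' u : walk v s w -> walk w s' u -> walk v (s ++ s') u.
Proof.
elim: s v => [|e s IH] v /=; first by move=> /eqP ->.
by move=> /and3P[-> -> /IH /[apply]].
Qed.

Lemma connect_walk v w : connect (@adjacent A G) v w -> exists s, walk v s w.
Proof.
move=> /connectP [p]; elim: p v => [|u p IH] v /=.
  by move=> _ ->; exists [::] => /=.
move=> /andP[/existsP [a va] /IH {}IH /IH [s us]]; exists ((v, u, a) :: s).
by rewrite /= va eqxx.
Qed.

Lemma walk_nth e0 v s w k : walk v s w -> k < size s ->
  [/\ nth e0 s k \in arcs G,
      k = 0 -> (nth e0 s k).1.1 = v &
      (nth e0 s k).1.2 = if k.+1 < size s then (nth e0 s k.+1).1.1 else w].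
Proof.
elim: s v k => [|e s IH] v [|k] //= /and3P[eG /eqP ev ws] ks.
  split=> //; case: s ws {IH ks} => [|e' s] /=; first by move/eqP.
  by move=> /and3P[_ /eqP].
by have [? _ ?] := IH _ _ ws ks.
Qed.

(** In a codeterministic graph a walk is recovered from its end and its labels,
    from the last arc to the first. *)
Lemma codeterministic_walk v v' s s' w :
  (forall e e', e \in arcs G -> e' \in arcs G ->
     e.1.2 = e'.1.2 -> e.2 = e'.2 -> e = e') ->
  walk v s w -> walk v' s' w -> map snd s = map snd s' -> s = s'.
Proof.
move=> codet; elim: s s' v v' => [|e s IH] [|e' s'] v v' //=.
move=> /and3P[eG _ ws] /and3P[eG' _ ws'] [lab labs].
have ss' := IH _ _ _ ws ws' labs.
congr cons => //; apply: codet => //.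
move: ws ws'; rewrite -{}ss'; case: s {IH labs} => [/eqP -> /eqP -> //|f s].
by move=> /and3P[_ /eqP <- _] /and3P[_ /eqP].
Qed.

(** Two loops at a vertex starting with distinct arcs, run in both orders, are
    distinct loops of equal length, and codeterminism makes their labels
    differ. *)
Lemma codeterministic_free_words (M : sidedness) :
  (forall e e', e \in arcs G -> e' \in arcs G ->
     e.1.2 = e'.1.2 -> e.2 = e'.2 -> e = e') ->
  ~ unique_returning_arc -> free_words (label_system G : set (full_shift M A)).
Proof.
move=> codet /existsNP [e /existsNP [e' /not_implyP [/andP[eG er]
  /not_implyP [/andP[eG' er'] /not_implyP [ee' ne]]]]].
have [s ws] := connect_walk er; have [s' ws'] := connect_walk er'.
pose v := e.1.1.
have we : walk v (e :: s) v by rewrite /= eG eqxx.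
have we' : walk v (e' :: s') v by rewrite /= eG' /v ee' eqxx.
pose d (b : bool) := if b then (e :: s) ++ e' :: s' else (e' :: s') ++ e :: s.
pose n := size (d true).
have dn b : size (d b) = n by case: b; rewrite /n /d !size_cat //= addnC.
have dw b : walk v (d b) v by case: b; [apply: walk_cat we we'|apply: walk_cat we' we].
have n0 : 0 < n by rewrite /n /d size_cat.
pose c b k := (nth e (d b) k).2.
have [q [qn cq]] : exists q, q < n /\ c true q != c false q.
  apply: contrapT => H; apply: ne.
  suff: d true = d false by case.
  apply: codeterministic_walk codet (dw _) (dw _) _.
  apply: (@eq_from_nth _ e.2); rewrite !size_map !dn // => k kn.
  rewrite !(nth_map e) ?dn //; apply: contrapT => /eqP ck.
  by apply: H; exists k.
exists n, c, q; split=> // z.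
exists (fun i => nth e (d (z (time_div i n))) (time_mod i n)).
have Hn (b : bool) (k : nat) (kn : k < n) := walk_nth e (dw b) (etrans (congr1 _ (dn b)) kn).
split=> [j|j|//]; first by have [] := Hn (z (time_div j n)) _ (time_mod_lt j n0).
have [_ _ ->] := Hn (z (time_div j n)) _ (time_mod_lt j n0).
have := time_succ_block j n0; rewrite dn; case: ifP => jn [-> ->] //.
by have [_ ->] := Hn (z (time_succ (time_div j n))) _ n0.
Qed.

End ReturningArcs.

(** * Eventual periodicity without branching *)

(** After at most [#|T|] steps the orbit has entered a cycle, whose length
    divides the factorial of [#|T|]. The period thus depends neither on [f] nor
    on [x]. *)
Lemma iter_add_fact (T : finType) (f : T -> T) x m :
  #|T| <= m -> iter (m + (#|T|)`!) f x = iter m f x.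
Proof.
move=> Tm.
have /loopingP /(_ #|T|) /trajectP [a aT E] : looping f x #|T|.
  apply: contraT; rewrite -looping_uniq => /card_uniqP E.
  by have := max_card [in traject f x #|T|.+1]; rewrite E size_traject ltnn.
have per k j : a <= k -> iter (k + j * (#|T| - a)) f x = iter k f x.
  move=> ak; elim: j => [|j IH]; first by rewrite addn0.
  rewrite -{}IH mulSn addnCA addnC; move: (j * _) => d.
  have -> : k + d + (#|T| - a) = k + d - a + #|T| by lia.
  by rewrite iterD E -iterD; congr (iter _ _ _); lia.
have /dvdnP [j ->] : #|T| - a %| (#|T|)`! by apply: dvdn_fact; lia.
by apply: per; lia.
Qed.

(** Wait until all values taken finitely often have disappeared. *)
Lemma eventually_recurrent (T : finType) (u : nat -> T) :
  exists N, forall i, N <= i -> exists2 j, i < j & u j = u i.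
Proof.
have /choice [f fP] t : exists N, (forall j, N <= j -> u j <> t) \/
    (forall i, exists2 j, i < j & u j = t).
  case: (pselect (exists N, forall j, N <= j -> u j <> t)) => [[N NP]|H].
    by exists N; left.
  exists 0; right => i; apply: contrapT => H'; apply: H; exists i.+1 => j ij ujt.
  by apply: H'; exists j.
exists (\max_t f t) => i fi; have [H|] := fP (u i); last exact.
by case: (H i) => //; apply: leq_trans fi; apply: leq_bigmax.
Qed.

Section Tails.
Variables (A : finType) (G : graph A).
Hypothesis uniq : unique_returning_arc G.
Local Notation V := (vertex G).
Local Notation arc := (V * V * A)%type.
Local Notation p := (#|vertex G|)`!.

Lemma deterministic_periodic (g : V -> arc) (e : nat -> arc) K m :
  (forall k, k <= K -> e k = g (e k).1.1) ->
  (forall k, (e k.+1).1.1 = (e k).1.2) ->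
  #|V| <= m -> m + p <= K -> e (m + p) = e m.
Proof.
move=> eg ec Vm mK.
have E k : k <= K -> (e k).1.1 = iter k (fun v => (g v).1.2) (e 0).1.1.
  elim: k => [//|k IH] kK; rewrite ec iterS -IH ?(ltnW kK) // -eg //.
  exact: ltnW.
have mK' : m <= K by apply: leq_trans mK; apply: leq_addr.
by rewrite (eg _ mK) (eg _ mK') (E _ mK) (E _ mK') iter_add_fact.
Qed.

Variable M : sidedness.
Variable x : full_shift M A.
Variable e : time M -> arc.
Hypotheses (eG : forall j, e j \in arcs G)
  (ec : forall j, (e (time_succ j)).1.1 = (e j).1.2) (ex : forall j, x j = (e j).2).

Lemma path_connect j k :
  connect (@adjacent A G) (e j).1.1 (e (time_add j k)).1.1.
Proof.
elim: k => [|k IH]; first by rewrite time_add0.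
by apply: connect_trans IH _; rewrite time_addS ec; apply: arc_connect.
Qed.

(** When returning arcs are unique, the source of a returning arc determines it,
    so that a path of returning arcs is an orbit of a self-map of the
    vertices. *)
Lemma returning_arc_choice : exists g : V -> arc, forall e', returning e' ->
  e' = g e'.1.1.
Proof.
have /choice [g gP] v : exists e', forall e1 : arc, returning e1 -> e1.1.1 = v -> e1 = e'.
  case: (pselect (exists e' : arc, returning e' /\ e'.1.1 = v)) => [[e' [re' <-]]|H].
    by exists e' => e1 re1; apply: uniq.
  by exists (e (time_of_nat M 0)) => e1 re1 e1v; case: H; exists e1.
by exists g => e' re'; apply: gP.
Qed.

Lemma returning_path j k :
  (e (time_add j k.+1)).1.1 = (e j).1.1 -> returning (e j).
Proof.
rewrite /returning eG /= -ec => <-.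
by rewrite -add1n -time_addA -time_succE path_connect.
Qed.

(** Late on the path every vertex occurs again later, so every arc is returning
    and the path follows a self-map of the finite vertex set. *)
Lemma right_periodic : exists N, forall k, N <= k ->
  x (time_of_nat M (k + p)) = x (time_of_nat M k).
Proof.
have [g gP] := returning_arc_choice.
have [N NP] := eventually_recurrent (fun i => (e (time_of_nat M i)).1.1).
exists (N + #|V|) => k Nk; rewrite !ex; congr snd.
have := @deterministic_periodic g (fun i => e (time_of_nat M (N + i)))
  (k - N + p) (k - N).
rewrite addnA subnKC; last by lia.
apply=> [i _|i||//]; last by lia.
- apply: gP; have [j ij jE] := NP (N + i) (leq_addr _ _).
  apply: (@returning_path _ (j - (N + i)).-1); rewrite time_of_nat_add -jE; congr (e _).1.1.
  by congr time_of_nat; lia.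
- by rewrite -ec time_succE time_of_nat_add addn1 addnS.
Qed.

(** The mirror image: far in the past every vertex occurs again earlier, so the
    target of an arc has occurred before the arc, which closes a loop. The path
    is still followed forwards in time, starting from an earlier point. *)
Lemma left_periodic (neg : nat -> time M) :
  (forall a b, time_add (neg (a + b)) b = neg a) ->
  exists N, forall k, N <= k -> x (neg (k + p)) = x (neg k).
Proof.
move=> negE; have [g gP] := returning_arc_choice.
have [N NP] := eventually_recurrent (fun i => (e (neg i)).1.1).
have ret i : N < i -> returning (e (neg i)).
  case: i => // i Ni; rewrite /returning eG -ec /=.
  have -> : time_succ (neg i.+1) = neg i by rewrite time_succE -addn1 negE.
  have [j ij <-] := NP i Ni.
  have <- : time_add (neg j) (j - i.+1) = neg i.+1.
    by rewrite -[in neg j](subnKC ij) negE.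
  exact: path_connect.
exists N.+1 => k Nk; rewrite !ex; congr snd.
have negV t : t <= #|V| + p ->
    time_add (neg (k + (#|V| + p))) t = neg (k + (#|V| + p - t)).
  by move=> tp; rewrite -[in LHS](subnK tp) addnA negE.
have tE := @deterministic_periodic g
  (fun t => e (time_add (neg (k + (#|V| + p))) t)) (#|V| + p) #|V|.
rewrite /= !negV ?leq_addr // subnn addn0 addKn in tE.
symmetry; apply: tE => [t tp|t||//].
- by apply: gP; rewrite negV //; apply: ret; apply: leq_trans Nk (leq_addr _ _).
- by rewrite -ec time_addS.
- exact: leqnn.
Qed.

End Tails.

(** Such a sequence is determined by a prefix and by the time [N]. *)
Lemma countable_eventually_periodic (A : finType) (p : nat) : 0 < p ->
  countable [set s : nat -> A | exists N, forall k, N <= k -> s (k + p) = s k].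
Proof.
move=> p0; case: (pselect (exists s : nat -> A, True)) => [[s0 _]|H]; last first.
  by apply: (@sub_countable _ _ _ set0) => //; apply: subset_card_le => s; case: H; exists s.
pose unroll (u : nat * seq A) : nat -> A := fun k =>
  nth (s0 0) u.2 (if k < u.1 then k else u.1 + (k - u.1) %% p).
apply: (@sub_countable _ _ _ (range unroll)); last first.
  exact: sub_countable (card_image_le _ _) (countableP _).
apply: subset_card_le => s [N NP]; exists (N, mkseq s (N + p)) => //.
apply/funext => k; rewrite /unroll /=.
case: (ltnP k N) => kN; first by rewrite nth_mkseq //; apply: leq_trans kN (leq_addr _ _).
rewrite nth_mkseq ?ltn_add2l ?ltn_mod //.
have per j i : N <= i -> s (i + j * p) = s i.
  move=> Ni; elim: j => [|j IH]; first by rewrite addn0.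
  by rewrite mulSn [p + _]addnC addnA NP //; lia.
rewrite -(per ((k - N) %/ p)); last exact: leq_addr.
by congr s; have := divn_eq (k - N) p; lia.
Qed.

Lemma unique_returning_countable (M : sidedness) (A : finType) (G : graph A) :
  unique_returning_arc G -> countable (label_system G : set (full_shift M A)).
Proof.
move=> uniq; pose p := (#|vertex G|)`!.
pose EP := [set s : nat -> A | exists N, forall k, N <= k -> s (k + p) = s k].
have cEP : countable EP by apply: countable_eventually_periodic; apply: fact_gt0.
case: M => /=.
  apply: sub_countable cEP; apply: subset_card_le => x [e [eG ec ex]].
  exact: (@right_periodic A G uniq OneSided x e).
have : countable (EP `*` EP) by exact: countableX.
pose f (x : full_shift TwoSided A) : (nat -> A) * (nat -> A) :=
  (fun k => x (Posz k), fun k => x (- Posz k)%R).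
have finj : injective f.
  move=> x y [/(congr1 (fun s => s _)) xy /(congr1 (fun s => s _)) xy'].
  apply/funext => -[k|k]; first exact: xy.
  by rewrite NegzE; apply: xy'.
apply: sub_countable.
pose L : set (full_shift TwoSided A) := label_system G.
have : (f @` L #= L)%card.
  by apply: inj_card_eq => x y _ _; apply: finj.
rewrite card_eq_le => /andP[_ le]; apply: card_le_trans le _.
apply: subset_card_le => _ [x [e [eG ec ex]] <-]; split.
  exact: (@right_periodic A G uniq TwoSided x e).
apply: (@left_periodic A G uniq TwoSided x e eG ec ex (fun k => (- Posz k)%R)).
by move=> a b /=; lia.
Qed.

(** A limit of shifts of a sequence that is eventually periodic to the right is
    periodic, at all times and with the same period. *)
Lemma unique_returning_asymptotically_periodic (M : sidedness) (A : finType)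
    (G : graph A) :
  unique_returning_arc G ->
  asymptotically_periodic (label_system G : set (full_shift M A)).
Proof.
move=> uniq; exists (#|vertex G|)`!; first exact: fact_gt0.
set p := _`!; move=> y [_ [x [e [eG ec ex]] [phi phi_mono phiy]]].
have [N NP] := @right_periodic A G uniq M x e eG ec ex; rewrite -/p in NP.
have phi_ge k : k <= phi k.
  by elim: k => // k IH; apply: leq_ltn_trans IH _; apply: phi_mono.
apply/funext => i; rewrite iter_shiftE.
have [K _ KP] := phiy _ (nbhs_agree (time_abs i + p).+1 y).
pose k := K + (time_abs i + N).
have yk j : time_abs j <= time_abs i + p -> y j = x (time_add j (phi k)).
  by move=> ji; rewrite (KP k (leq_addr _ _) j) // iter_shiftE.
rewrite !yk ?time_abs_add ?leq_addr // time_addA [p + _]addnC -time_addA.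
have [j Nj ->] : exists2 j, N <= j & time_add i (phi k) = time_of_nat M j.
  by apply: time_add_large; apply: leq_trans (phi_ge k); apply: leq_addl.
by rewrite time_of_nat_add NP.
Qed.

(** * Transitive subsystems of asymptotically periodic subshifts *)

(** Baire's theorem for a closed set of sequences: nested cylinders centred at
    points of the set have a common point by compactness. *)
Lemma residual_nonempty (M : sidedness) (A : finType) (Y : set (full_shift M A))
    (S : set (set_type Y)) :
  closed Y -> Y !=set0 -> residual S -> S !=set0.
Proof.
move=> cY [y0 Yy0] [_ [F Fod ->] FS].
have step (i : nat) (u : set_type Y * nat) : exists u' : set_type Y * nat,
    [/\ u.2 <= u'.2, agree u.2 (set_val u.1) (set_val u'.1) &
        forall z, agree u'.2 (set_val u'.1) (set_val z) -> F i z].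
  case: u => y m; have [oF dF] := Fod i.
  have oC : open (set_val @^-1` [set z | agree m (set_val y) z] : set (set_type Y)).
    exists [set z | agree m (set_val y) z] => //.
    by apply/open_agreeP => z yz; exists m => z'; apply: agree_trans.
  have [y' [yy' Fy']] : set_val @^-1` [set z | agree m (set_val y) z] `&` F i !=set0.
    by apply: dF => //; exists y; apply: agreexx.
  case: oF => V /open_agreeP oV VF; rewrite -VF in Fy'.
  have [m' m'V] := oV _ Fy'; exists (y', maxn m m'); split; rewrite ?leq_maxl //.
  by move=> z /(agree_le (leq_maxr _ _)) yz; rewrite -VF; apply: m'V.
have /all_tag [f fP] := fun i => choice (step i).
pose s := fix s i := if i is i'.+1 then f i' (s i')
  else (SigSub (mem_set Yy0) : set_type Y, 0).
have sle i k : agree (s i).2 (set_val (s i).1) (set_val (s (i + k)).1) /\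
    (s i).2 <= (s (i + k)).2.
  elim: k => [|k [IH1 IH2]]; first by rewrite addn0.
  rewrite addnS /=; have [le ag _] := fP (i + k) (s (i + k)); split.
    by apply: agree_trans IH1 _; apply: agree_le ag.
  exact: leq_trans le.
have [x xs] := cluster_agree (fun n => set_val (s n).1).
have Yx : Y x.
  move/closed_agreeP: cY; apply=> m; have [n _ xn] := xs m 0.
  by exists (set_val (s n).1) => //; apply: set_valP.
exists (SigSub (mem_set Yx)); apply: FS => i _.
have [_ _ FP] := fP i (s i); apply: FP.
have [n ni xn] := xs (s i.+1).2 i.+1.
have [ag _] := sle i.+1 (n - i.+1); rewrite subnKC // in ag.
by apply: agree_trans ag _; apply: agree_sym.
Qed.

(** A point with dense orbit is either periodic, and then its orbit is finite
    and closed, or an adhering value of its own orbit. *)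
Lemma asymptotically_periodic_transitive_finite (M : sidedness) (A : finType)
    (Sigma Y : set (full_shift M A)) :
  asymptotically_periodic Sigma -> subsystem Sigma (@shift M A) Y ->
  transitive_system (@shift M A) Y -> finite_set Y.
Proof.
move=> [p p1 pP] [YS Y0 cY FY] /(residual_nonempty cY Y0) [y0 dy].
set y := set_val y0 in dy; have Yy : Y y by apply: set_valP.
have ret m z : Y z -> exists2 t, 1 <= t & agree m z (iter t (@shift M A) y).
  move=> Yz.
  have [] := dy (set_val @^-1` [set z' | agree m z z']).
  - by exists (SigSub (mem_set Yz)); apply: agreexx.
  - exists [set z' | agree m z z'] => //.
    by apply/open_agreeP => z1 zz1; exists m => z2; apply: agree_trans.
  - by move=> w [zw [t t1 wE]]; exists t => //; rewrite -wE.
have periodic_finite q : 1 <= q -> iter q (@shift M A) y = y -> finite_set Y.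
  move=> q1 qy; pose O := (fun t => iter t (@shift M A) y) @` `I_q.
  have fO : finite_set O by apply: finite_image; apply: finite_II.
  apply: (sub_finite_set _ fO) => z Yz.
  have cO : closed O.
    move: (O) fO; apply/accessible_finite_set_closed/hausdorff_accessible.
    exact: full_shift_hausdorff.
  move/closed_agreeP: cO; apply=> m; have [t _ zt] := ret m z Yz.
  exists (iter t (@shift M A) y) => //; exists (t %% q); first by rewrite /= ltn_mod.
  rewrite [in RHS](divn_eq t q) addnC iterD; congr iter.
  by elim: (t %/ q) => // k IH; rewrite mulSn iterD -IH.
case: (pselect (exists2 q, 1 <= q & iter q (@shift M A) y = y)) => [[q]|aper].
  exact: periodic_finite.
apply: (periodic_finite p) => //; apply: pP; split; first exact: YS.
exists y; first exact: YS.
(* If y is not periodic, returns to a small enough cylinder around y take more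
   than any given time N. *)
have late N m : exists t, N < t /\ agree m y (iter t (@shift M A) y).
  have [m' m'P] : exists m', forall t, 1 <= t <= N ->
      ~ agree m' y (iter t (@shift M A) y).
    elim: N => [|N [m' IH]]; first by exists 0 => t; lia.
    have [i yi] : exists i, y i <> iter N.+1 (@shift M A) y i.
      apply: contrapT => H; apply: aper; exists N.+1 => //; apply/funext => i.
      by apply: contrapT => yi; apply: H; exists i => /esym.
    exists (maxn m' (time_abs i).+1) => t /andP[t1].
    rewrite leq_eqVlt => /orP[/eqP -> yt|tN /(agree_le (leq_maxl _ _))].
      by apply: yi; apply: yt; rewrite leq_maxr.
    by apply: IH; rewrite t1.
  have [t t1 yt] := ret (maxn m m') y Yy; exists t; split.
    rewrite ltnNge; apply/negP => tN; apply: (m'P t); first by rewrite t1.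
    exact: agree_le (leq_maxr _ _) yt.
  exact: agree_le (leq_maxl _ _) yt.
have /all_tag [g gP] := fun N => choice (late N).
pose phi := fix phi k := if k is k'.+1 then g (phi k') k else g 0 0.
exists phi.
  by apply: homo_ltn => [? ? ? |k]; [exact: ltn_trans | have [] := gP (phi k) k.+1].
move=> U /nbhs_agreeP [m mU]; exists m => // k /= mk; apply: mU.
have phiP : agree k y (iter (phi k) (@shift M A) y).
  by case: k {mk} => [|k]; [have [] := gP 0 0 | have [] := gP (phi k) k.+1].
exact: agree_le mk phiP.
Qed.

(** * The equivalences *)

Theorem proposition25 (M : sidedness) (A : finType)
    (Sigma : set (full_shift M A))
    (Sigma_subshift : subshift Sigma) (Sigma_sofic : sofic Sigma) :
  [<-> ~ universal Sigma;
       countable Sigma;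
       asymptotically_periodic Sigma;
       ~ (exists Y : set (full_shift M A),
            [/\ subsystem Sigma (@shift M A) Y,
                transitive_system (@shift M A) Y &
                infinite_set Y]);
       exists2 G : graph A, Sigma = label_system G &
         ~ (exists C : {set vertex G},
              strongly_connected_component C /\ non_cyclic C)].
Proof.
pose acyclic := exists2 G : graph A, Sigma = label_system G & unique_returning_arc G.
have acyclicP : acyclic <-> exists2 G : graph A, Sigma = label_system G &
    ~ (exists C : {set vertex G}, strongly_connected_component C /\ non_cyclic C).
  by split=> -[G SG /no_non_cyclicP uG]; exists G.
have dichotomy : acyclic \/ free_words Sigma.
  have [G SG] := Sigma_sofic.
  have SP : Sigma = label_system (preimage_graph G).
    by rewrite SG label_system_preimage_graph.
  case: (pselect (unique_returning_arc (preimage_graph G))) => uG.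
    by left; exists (preimage_graph G).
  right; rewrite SP; apply: codeterministic_free_words uG.
  exact: preimage_graph_codeterministic.
have acyclic_countable : acyclic -> countable Sigma.
  by move=> [G -> uG]; apply: unique_returning_countable.
have acyclic_periodic : acyclic -> asymptotically_periodic Sigma.
  by move=> [G -> uG]; apply: unique_returning_asymptotically_periodic.
have not_universal_acyclic : ~ universal Sigma -> acyclic.
  by case: dichotomy => // fw []; apply: free_words_universal.
have periodic_no_transitive : asymptotically_periodic Sigma ->
    ~ (exists Y : set (full_shift M A), [/\ subsystem Sigma (@shift M A) Y,
         transitive_system (@shift M A) Y & infinite_set Y]).
  move=> apS [Y [sY tY]]; apply.
  exact: (asymptotically_periodic_transitive_finite apS sY tY).
have no_transitive_acyclic : ~ (exists Y : set (full_shift M A),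
    [/\ subsystem Sigma (@shift M A) Y, transitive_system (@shift M A) Y &
        infinite_set Y]) -> acyclic.
  by case: dichotomy => // fw []; apply: free_words_transitive.
tfae.
- by move=> /not_universal_acyclic.
- by move=> /countable_not_universal/not_universal_acyclic.
- exact: periodic_no_transitive.
- by move=> /no_transitive_acyclic/acyclicP.
- by move=> /acyclicP/acyclic_countable/countable_not_universal.
Qed.
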